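(* If $q$ is a power of an odd prime, then $\triangle(q^{10})\ge q^{17}+q^{15}$.
   Context: All graphs are finite and simple. For a positive integer $k$, $\triangle(k)$ denotes the maximum number of triangles in a $3$-partite graph $G$ with exactly $k$ vertices in each of its three parts (each part being an independent set) such that, for any two of the three parts, the bipartite graph induced by these two parts contains no cycle of length four. *)

(* Defs.v *)
From mathcomp Require Import all_boot.

Set Implicit Arguments.
Unset Strict Implicit.
Unset Printing Implicit Defensive.

Section Graphs.

Variable V : finType.
Implicit Types (e : rel V) (S : {set V}).

Definition simple_graph e : bool :=
  [forall x, ~~ e x x] && [forall x, forall y, e x y == e y x].

Definition induced e S : rel V := [rel x y | [&& x \in S, y \in S & e x y]].

Definition has_C4 e : bool := [exists c : 4.-tuple V, ucycleb e c].

Definition triangles e : {set {set V}} :=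
  [set t : {set V} | (#|t| == 3) &&
    [forall x in t, forall y in t, (x != y) ==> e x y]].

Variable part : V -> 'I_3.

Definition parts_independent e : bool :=
  [forall x, forall y, (part x == part y) ==> ~~ e x y].

Definition pairs_C4_free e : bool :=
  [forall i, forall j, (i != j) ==>
    ~~ has_C4 (induced e [set x | (part x == i) || (part x == j)])].

End Graphs.

(* A 3-partite graph with exactly k vertices in each part is, up to
   isomorphism, a graph on 'I_3 * 'I_k whose parts are the fibres of the first
   projection; its adjacency relation is stored as a set E of ordered pairs, so
   that the maximum ranges over a finite type. *)
Definition vertex (k : nat) : finType := ('I_3 * 'I_k)%type.

Definition vertex_part (k : nat) (x : vertex k) : 'I_3 := x.1.

Definition adj (k : nat) (E : {set vertex k * vertex k}) : rel (vertex k) :=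
  [rel x y | (x, y) \in E].

Definition admissible (k : nat) (e : rel (vertex k)) : bool :=
  [&& simple_graph e, parts_independent (@vertex_part k) e
    & pairs_C4_free (@vertex_part k) e].

Definition max_triangles (k : nat) : nat :=
  \max_(E : {set vertex k * vertex k} | admissible (adj E)) #|triangles (adj E)|.

(* Main.v *)
Require Import Defs.
From mathcomp Require Import all_boot all_algebra all_field.
From mathcomp Require Import ring zify.

Set Implicit Arguments.
Unset Strict Implicit.
Unset Printing Implicit Defensive.
Import GRing.Theory.
Local Open Scope ring_scope.

(** Let K be the field with q^5 elements and identify each part with K x K.
    Join the vertex (a, a2) of part i to the vertex (b, b2) of part i + 1 when
    a2 - b2 = e_i(a, b).  If the second difference of each e_i vanishes only
    trivially, then no two parts span a four-cycle.  Around a triangle the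
    second coordinates cancel, so the triangles with first coordinates a, b, c
    exist, q^5 at a time, exactly when e_0(a, b) + e_1(b, c) + e_2(c, a) = 0
    ([card_solutions_le_max_triangles]).

    Take e_i(a, b) = B(a, b) + h(a), minus a constant t for i = 0, where
    h(y) = y^(q+1) + x^q y^(q^3) and B(a, b) = a b^q + a^q b is the polar form
    of h.  Since q is odd and 5 is odd, -1 is not a (q-1)-st power in K, so B
    has no zero divisors ([polar_eq0]).  The sum around a triangle is
    h(a + b + c) - t, hence there are q^15 triangles for each solution y of
    h(y) = t, and it is enough to choose x and t so that this equation has at
    least q^2 + 1 solutions: q^15 (q^2 + 1) = q^17 + q^15.

    This is done with decomposable bivectors of K over its subfield F of q
    elements.  A pair (u, v) in K x K has the ten Pluecker coordinates
    p_ij = u^(q^i) v^(q^j) - u^(q^j) v^(q^i), 0 <= i < j <= 4; up to sign they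
    are the conjugates of x = p_01 and y = p_02.  In terms of x and y the
    relation p_01 p_23 - p_02 p_13 + p_03 p_12 = 0 reads h(y) = t with
    t = x^(1 + q^2) ([plucker_relation]).  The pairs with x <> 0 number
    (q^5 - 1)(q^5 - q), and at most (q^2 - 1) q of them share the same (x, y)
    (they are bases of one F-plane with prescribed determinant), so at least
    (q^5 - 1)(q^2 + 1) pairs (x, y) arise, and some x <> 0 occurs with at least
    q^2 + 1 values of y ([ex_large_level]). *)

(** * Decomposable bivectors over a quintic extension *)

Lemma card_root_le (K : finFieldType) (f : {poly K}) (d : nat) :
  f != 0 -> (size f <= d.+1)%N -> (#|[set z | root f z]| <= d)%N.
Proof.
move=> f0 sf; rewrite -ltnS (leq_trans _ sf) // cardE.
apply: max_poly_roots (enum_uniq _) => //.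
by apply/allP=> z; rewrite mem_enum inE.
Qed.

Section Bivectors.

Variables (K : finFieldType) (p q : nat).
Hypotheses (p_char : p \in [pchar K]) (p_odd : odd p) (p_q : p.-nat q).
Hypotheses (q_odd : odd q) (q_gt1 : (1 < q)%N) (card_K : #|K| = (q ^ 5)%N).
Implicit Types x y z u v : K.

Lemma frobD u v : (u + v) ^+ q = u ^+ q + v ^+ q.
Proof. by apply: exprDn_pchar; rewrite (eq_pnat _ (pcharf_eq p_char)). Qed.

Lemma frobN u : (- u) ^+ q = - u ^+ q.
Proof. by rewrite exprNn -signr_odd q_odd mulN1r. Qed.

Lemma frobB u v : (u - v) ^+ q = u ^+ q - v ^+ q.
Proof. by rewrite frobD frobN. Qed.

Lemma frobX u i : (u ^+ (q ^ i)) ^+ q = u ^+ (q ^ i.+1).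
Proof. by rewrite -exprM -expnSr. Qed.

Lemma frobDX i u v : (u + v) ^+ (q ^ i) = u ^+ (q ^ i) + v ^+ (q ^ i).
Proof. by elim: i => [|i IH]; rewrite ?expr1 // -!frobX IH frobD. Qed.

Lemma frobBX i u v : (u - v) ^+ (q ^ i) = u ^+ (q ^ i) - v ^+ (q ^ i).
Proof. by elim: i => [|i IH]; rewrite ?expr1 // -!frobX IH frobB. Qed.

Lemma frob5 u : u ^+ (q ^ 5) = u.
Proof. by rewrite -card_K expf_card. Qed.

Definition polar u v := u * v ^+ q + u ^+ q * v.

(** A zero with u, v <> 0 gives r = u / v with r^q = - r.  Applying Frobenius five
    times gives r = - r, since five is odd; this is impossible as p is odd. *)
Lemma polar_eq0 u v : polar u v = 0 -> u = 0 \/ v = 0.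
Proof.
move=> E; have [->|v0] := eqVneq v 0; first by right.
left; apply/eqP; apply: contraT => u0.
pose r := u / v; have r0 : r != 0 by rewrite mulf_neq0 ?invr_eq0.
have rq : r ^+ q = - r.
  apply/eqP; rewrite -addr_eq0 exprMn exprVn /r.
  have vq : v ^+ q != 0 by rewrite expf_neq0.
  apply/eqP; transitivity (polar u v / (v * v ^+ q)); last by rewrite E mul0r.
  by rewrite /polar; field; rewrite v0 vq.
have r2 : r ^+ (q ^ 2) = r by rewrite -frobX expn1 rq frobN rq opprK.
have r5 : r ^+ (q ^ 5) = - r.
  by rewrite (expnD q 2 3) exprM r2 (expnD q 2 1) exprM r2 expn1.
have /eqP : r *+ 2 = 0 by rewrite mulr2n -{1}(frob5 r) r5 addNr.
rewrite -mulr_natr mulf_eq0 (negbTE r0) /= => two0.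
have : 2%N \in [pchar K] by rewrite inE /= two0.
by rewrite (pcharf_eq p_char) inE => /eqP p2; move: p_odd; rewrite -p2.
Qed.

(** For a suitable right-hand side this is the Pluecker relation satisfied by
    p_01 = x and p_02 = y; see [plucker_relation]. *)
Definition quad x y := y * y ^+ q + x ^+ q * y ^+ (q ^ 3).

Lemma polarB a a' b b' :
  polar (a - a') (b - b') = polar a b - polar a' b - polar a b' + polar a' b'.
Proof. by rewrite /polar !frobB; ring. Qed.

(** The term y^(q^3) is additive, so [quad x] is a quadratic map with polar form
    [polar]: the value at a sum of three elements splits into functions of two. *)
Lemma quadD3 x a b c :
  quad x (a + b + c) =
    quad x a + quad x b + quad x c + polar a b + polar b c + polar c a.
Proof. by rewrite /quad /polar !frobDX !frobD; ring. Qed.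

Definition plucker01 u v := u * v ^+ q - u ^+ q * v.
Definition plucker02 u v := u * v ^+ (q ^ 2) - u ^+ (q ^ 2) * v.

(** This is p_01 p_23 - p_02 p_13 + p_03 p_12 = 0, where p_12, p_23 and p_13 are
    Frobenius conjugates of p_01 and p_02, and p_03 = - p_02^(q^3) because the
    fifth power of Frobenius is the identity. *)
Lemma plucker_relation u v (x := plucker01 u v) (y := plucker02 u v) :
  quad x y = x * x ^+ (q ^ 2).
Proof.
rewrite /quad /x /y /plucker01 /plucker02 !frobBX !frobB !exprMn.
rewrite -!exprM -!expnD -!expnSr -!expnS !frob5; ring.
Qed.

(** The three-fold wedge of u, v and u is zero.  As the left side only involves
    x and y, it confines u to the roots of a polynomial depending on (x, y). *)
Lemma plucker_span u v (x := plucker01 u v) (y := plucker02 u v) :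
  x * u ^+ (q ^ 2) - y * u ^+ q + x ^+ q * u = 0.
Proof.
rewrite /x /y /plucker01 /plucker02 !frobB !exprMn -!exprM mulnn; ring.
Qed.

Lemma card_plucker01_le u x : u != 0 -> (#|[set v | plucker01 u v == x]| <= q)%N.
Proof.
move=> u0; set f : {poly K} := u *: 'X^q - (u ^+ q *: 'X + x%:P).
have sg : (size (- (u ^+ q *: 'X + x%:P)) < q.+1)%N.
  rewrite size_polyN -mul_polyC size_MXaddC; case: ifP => // _.
  by rewrite ltnS (leq_ltn_trans (size_polyC_leq1 _)).
have sf : size f = q.+1 by rewrite size_polyDl size_scale ?size_polyXn.
have f0 : f != 0 by rewrite -size_poly_eq0 sf.
apply: leq_trans (card_root_le f0 (eq_leq sf)).
apply/subset_leq_card/subsetP=> v; rewrite !inE => /eqP vx.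
rewrite rootE /f !hornerE -vx /plucker01; apply/eqP; ring.
Qed.

Lemma card_span_le x y : x != 0 ->
  (#|[set u : K | (u != 0%R) &&
       (x * u ^+ (q ^ 2) - y * u ^+ q + x ^+ q * u == 0)%R]|
    <= (q ^ 2).-1)%N.
Proof.
move=> x0.
(* The linearized polynomial of degree q ^ 2, divided by the variable. *)
set f : {poly K} := x *: 'X^((q ^ 2).-1) - (y *: 'X^(q.-1) - (x ^+ q)%:P).
have sg : (size (- (y *: 'X^(q.-1) - (x ^+ q)%:P)) < (q ^ 2).-1.+1)%N.
  rewrite size_polyN (leq_ltn_trans (size_polyD _ _)) // gtn_max size_polyN.
  rewrite (leq_ltn_trans (size_scale_leq _ _)) ?size_polyXn /=; last by nia.
  by rewrite (leq_ltn_trans (size_polyC_leq1 _)) //; nia.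
have sf : size f = (q ^ 2).-1.+1 by rewrite size_polyDl size_scale ?size_polyXn.
have f0 : f != 0 by rewrite -size_poly_eq0 sf.
apply: leq_trans (card_root_le f0 (eq_leq sf)).
apply/subset_leq_card/subsetP=> u; rewrite !inE => /andP[u0 /eqP E].
rewrite rootE /f !hornerE.
have q0 : (0 < q)%N by apply: ltnW.
have q20 : (0 < q ^ 2)%N by rewrite expn_gt0 q0.
rewrite -(mulIr_eq0 _ (mulIf u0)) -E; apply/eqP.
rewrite -[in RHS](prednK q20) -[in X in y * X](prednK q0) !exprSr.
ring.
Qed.

(** Count u first, by [plucker_span], and then v for a given u. *)
Lemma card_plucker_fibre_le x y : x != 0 ->
  (#|[set w : K * K | (plucker01 w.1 w.2 == x) && (plucker02 w.1 w.2 == y)]|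
    <= (q ^ 2).-1 * q)%N.
Proof.
move=> x0.
set D := [set u : K | (u != 0) &&
  (x * u ^+ (q ^ 2) - y * u ^+ q + x ^+ q * u == 0)].
rewrite -sum1_card (partition_big fst (mem D)) /=; last first.
  move=> [u v]; rewrite inE /= => /andP[/eqP xE /eqP yE].
  rewrite inE -xE -yE plucker_span eqxx andbT.
  apply: contraNneq x0 => u0.
  rewrite -xE /plucker01 u0 expr0n -[q == 0%N]negbK -lt0n (ltnW q_gt1).
  by rewrite !mul0r subr0.
apply: (@leq_trans (\sum_(u in D) q)); last first.
  by rewrite sum_nat_const leq_mul2r card_span_le ?orbT.
apply: leq_sum => u; rewrite inE => /andP[u0 _].
apply: leq_trans (card_plucker01_le x u0).
have pair_inj : injective (pair u : K -> K * K) by move=> v v' [].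
rewrite sum1_card -(card_imset (mem [set v | plucker01 u v == x]) pair_inj).
apply/subset_leq_card/subsetP=> -[u' v]; rewrite -topredE /= inE /=.
by case/andP=> /andP[uv _] /eqP <-; apply: imset_f; rewrite inE.
Qed.

Definition level x := [set y | quad x y == x * x ^+ (q ^ 2)].

(** Count the pairs (u, v) with nonzero first Pluecker coordinate in two ways: if
    every level had at most q^2 elements, then (q^5 - 1)(q^5 - q) would be at most
    (q^5 - 1) q^2 (q^2 - 1) q, that is, q^5 - q <= q^5 - q^3. *)
Lemma ex_large_level : exists x, (q ^ 2 < #|level x|)%N.
Proof.
apply/existsP; apply: contraT; rewrite negb_exists => /forallP lvl.
pose N := (q ^ 5)%N.
have ub : (\sum_(w : K * K | plucker01 w.1 w.2 != 0%R) 1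
    <= N.-1 * (q ^ 2 * ((q ^ 2).-1 * q)))%N.
  rewrite (partition_big (fun w => plucker01 w.1 w.2) (predC1 0)) //=.
  rewrite /N -card_K -(cardC1 0) -sum_nat_const.
  apply: leq_sum => x x0.
  rewrite (partition_big (fun w => plucker02 w.1 w.2) (mem (level x))) /=;
    last first.
    by move=> [u v] /= /andP[_ /eqP <-]; rewrite inE; apply/eqP/plucker_relation.
  have := lvl x; rewrite -leqNgt => lx.
  apply: (@leq_trans (\sum_(y in level x) (q ^ 2).-1 * q)); last first.
    by rewrite sum_nat_const leq_mul2r lx orbT.
  apply: leq_sum => y _; apply: leq_trans (card_plucker_fibre_le y x0).
  rewrite -sum1_card; apply: eq_leq; apply: eq_bigl => w; rewrite inE.
  by case: (plucker01 _ _ =P x) => [->|_]; rewrite ?(x0 : x != 0) ?andbF.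
have lb : (N.-1 * (N - q) <= \sum_(w : K * K | plucker01 w.1 w.2 != 0%R) 1)%N.
  rewrite -(pair_big_dep xpredT (fun u v => plucker01 u v != 0) (fun _ _ => 1%N)) /=.
  rewrite (bigID (predC1 0)) /= -[leqLHS]addn0 leq_add //.
  rewrite /N -card_K -(cardC1 0) -sum_nat_const; apply: leq_sum => u u0.
  rewrite sum1_card leq_subLR -(cardC [pred v | plucker01 u v == 0]) leq_add2r.
  by apply: leq_trans (card_plucker01_le 0 u0); rewrite cardsE.
have := leq_trans lb ub; rewrite leq_mul2l /N.
have -> : (q ^ 2 * ((q ^ 2).-1 * q) = q ^ 5 - q ^ 3)%N.
  by rewrite mulnCA -subn1 mulnBl mul1n -expnSr -expnD.
have : (q ^ 0 < q ^ 5)%N by rewrite ltn_exp2l.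
have : (q ^ 1 < q ^ 3)%N by rewrite ltn_exp2l.
have : (q ^ 3 < q ^ 5)%N by rewrite ltn_exp2l.
rewrite expn0 expn1; lia.
Qed.

End Bivectors.

(** * A tripartite graph from functions of two variables *)

Section TripartiteGraph.

Variables (K : finZmodType) (e : 'I_3 -> K -> K -> K).

(* For a function of a - b this is planarity in the sense of finite geometry. *)
Hypothesis e_planar : forall i a a' b b',
  e i a b - e i a' b - e i a b' + e i a' b' = 0 -> a = a' \/ b = b'.

Local Notation k := #|{: K * K}|.
Implicit Types x y : vertex k.

Definition coord (x : vertex k) : K * K := enum_val x.2.

Definition point (i : 'I_3) (a : K * K) : vertex k := (i, enum_rank a).

(** Parts are cyclically ordered by the addition of 'I_3, which is that of Z/3, so
    that one formula serves all three pairs of parts. *)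
Definition arc (x y : vertex k) : bool :=
  (y.1 == x.1 + 1) &&
  ((coord x).2 - (coord y).2 == e x.1 (coord x).1 (coord y).1).

Definition edge (x y : vertex k) : bool := arc x y || arc y x.

Definition edge_set : {set vertex k * vertex k} := [set z | edge z.1 z.2].

Lemma adj_edge_set x y : adj edge_set x y = edge x y.
Proof. by rewrite /adj /= inE. Qed.

Lemma coord_point i a : coord (point i a) = a.
Proof. by rewrite /coord /= enum_rankK. Qed.

Lemma vertex_inj x y :
  x.1 = y.1 -> (coord x).1 = (coord y).1 -> (coord x).2 = (coord y).2 -> x = y.
Proof.
rewrite /coord; case: x y => [i x] [j y] /= -> E1 E2; congr pair.
by apply: enum_val_inj; rewrite [LHS]surjective_pairing E1 E2 -surjective_pairing.
Qed.

Lemma I3_add1_neq (i : 'I_3) : (i + 1 == i) = false.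
Proof. by case: i => [[|[|[|]]]]. Qed.

Lemma I3_add2_neq (i : 'I_3) : (i == i + 1 + 1) = false.
Proof. by case: i => [[|[|[|]]]]. Qed.

Lemma edge_part x y : edge x y -> y.1 != x.1.
Proof.
by case/orP=> /andP[/eqP-> _]; rewrite ?I3_add1_neq // eq_sym I3_add1_neq.
Qed.

Lemma edge_sym x y : edge x y = edge y x.
Proof. by rewrite /edge orbC. Qed.

Lemma edge_arc x y : y.1 = x.1 + 1 -> edge x y -> arc x y.
Proof.
move=> yx /orP[//|/andP[/eqP xy _]].
by have := I3_add2_neq x.1; rewrite {1}xy yx eqxx.
Qed.

(** The four equations of a four-cycle, added with alternating signs, eliminate the
    second coordinates and leave a vanishing second difference of e. *)
Lemma arc_C4 x y u v :
  arc x u -> arc y u -> arc x v -> arc y v -> x.1 = y.1 -> x = y \/ u = v.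
Proof.
case/andP=> /eqP uE /eqP xu /andP[_ /eqP yu].
case/andP=> /eqP vE /eqP xv /andP[_ /eqP yv] xy.
have uv : u.1 = v.1 by rewrite uE vE.
move: yu yv; rewrite -xy => yu yv.
have /e_planar[E|E] :
  e x.1 (coord x).1 (coord u).1 - e x.1 (coord y).1 (coord u).1
  - e x.1 (coord x).1 (coord v).1 + e x.1 (coord y).1 (coord v).1 = 0.
- rewrite -xu -yu -xv -yv.
  move: (coord x).2 (coord y).2 (coord u).2 (coord v).2 => a b c d.
  have cancel (s t r : K) : s - r - (t - r) = s - t by rewrite opprB addrA subrK.
  by rewrite cancel -addrA [- _ + _]addrC cancel -(opprB a b) subrr.
- left; apply: vertex_inj => //.
  by move: xu; rewrite E -yu => /addIr.
- right; apply: vertex_inj => //.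
  by move: xu; rewrite E -xv => /addrI/oppr_inj.
Qed.

(** The sides of a four-cycle are arcs all leading from one of its two parts to the
    other, so [arc_C4] applies after exchanging the parts if necessary. *)
Lemma edge_C4 x y u v : x.1 = y.1 -> u.1 = v.1 ->
  edge x u -> edge u y -> edge y v -> edge v x -> x = y \/ u = v.
Proof.
move=> xy uv xu uy yv vx.
case/orP: (xu) => a.
  have [/eqP ux _] := andP a.
  apply: (arc_C4 a) => //; apply: edge_arc; rewrite -?xy -?uv //.
  - by rewrite edge_sym.
  - by rewrite edge_sym.
have [/eqP xu1 _] := andP a.
suff: u = v \/ x = y by case; [right|left].
apply: (arc_C4 a) => //; apply: edge_arc; rewrite -?xy -?uv //.
by rewrite edge_sym.
Qed.

Lemma two_parts (a b i j c : 'I_3) :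
  (a == i) || (a == j) -> (b == i) || (b == j) -> (c == i) || (c == j) ->
  b != a -> c != b -> a = c.
Proof.
by do 3![case/orP=> /eqP->]; rewrite ?eqxx.
Qed.

Lemma admissible_edge_set : admissible (adj edge_set).
Proof.
apply/and3P; split.
- apply/andP; split.
    apply/forallP=> x; rewrite adj_edge_set.
    by apply/negP=> /edge_part; rewrite eqxx.
  by apply/'forall_forallP=> x y; rewrite !adj_edge_set edge_sym.
- apply/'forall_forallP=> x y; rewrite adj_edge_set /vertex_part.
  apply/implyP=> /eqP xy; apply/negP=> /edge_part.
  by rewrite xy eqxx.
apply/'forall_forallP=> i j; apply/implyP=> _.
apply/existsPn=> -[[|x [|u [|y [|v [|]]]]] //= _].
rewrite /ucycleb /cycle /= !inE !andbT; apply/negP=> /andP[].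
case/and4P=> /and3P[xP uP xu] /and3P[_ yP uy] /and3P[_ vP yv] /and3P[_ _ vx].
rewrite !negb_or; case/and3P=> /and3P[_ nxy _] /andP[_ nuv] _.
move: xu uy yv vx; rewrite -!/(adj _ _ _) !adj_edge_set => xu uy yv vx.
rewrite !inE in xP uP yP vP.
have xy := two_parts xP uP yP (edge_part xu) (edge_part uy).
have uv := two_parts uP yP vP (edge_part uy) (edge_part yv).
by case: (edge_C4 xy uv xu uy yv vx) => E; move: nxy nuv; rewrite E eqxx.
Qed.

Definition solutions : {set K * K * K} :=
  [set s | e 0 s.1.1 s.1.2 + e 1 s.1.2 s.2 + e (1 + 1) s.2 s.1.1 == 0].

(** The second coordinate h of the corner in part 0 is free; the arcs to parts 1 and
    2 then force the other two second coordinates. *)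
Definition corner (z : K * (K * K * K)) (i : 'I_3) : vertex k :=
  let: (h, (a, b, c)) := z in
  point i (if i == 0 then (a, h) else if i == 1 then (b, h - e 0 a b)
        else (c, h - e 0 a b - e 1 b c)).

Definition triangle_of z : {set vertex k} := [set corner z i | i : 'I_3].

Lemma corner_part z i : (corner z i).1 = i.
Proof. by case: z => h [[a b] c]. Qed.

Lemma corner_inj z : injective (corner z).
Proof. by move=> i j E; rewrite -(corner_part z i) E corner_part. Qed.

(** Only the arc closing the triangle, from part 2 back to part 0, uses the equation
    that defines [solutions]. *)
Lemma corner_arc z i : z.2 \in solutions -> arc (corner z i) (corner z (i + 1)).
Proof.
case: z => h [[a b] c] /=; rewrite inE /= => /eqP E.
rewrite /arc !coord_point /= eqxx /=.
have [->|[->|->]] : i = 0 \/ i = 1 \/ i = 1 + 1.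
- by case: i => [[|[|[|]]]] // p; [left|right;left|right;right]; apply/val_inj.
- by rewrite /= opprB addrC subrK.
- by rewrite /= opprB addrCA subrr addr0.
rewrite /= eq_sym -subr_eq0 opprB -[h - _ - _]addrA -opprD.
by rewrite [h - _]subKr addrC E.
Qed.

Lemma triangle_of_triangle z :
  z.2 \in solutions -> triangle_of z \in triangles (adj edge_set).
Proof.
move=> zS; rewrite inE card_imset ?card_ord ?eqxx /=; last exact: corner_inj.
apply/forall_inP=> _ /imsetP[i _ ->]; apply/forall_inP=> _ /imsetP[j _ ->].
rewrite (inj_eq (@corner_inj z)) adj_edge_set; apply/implyP=> ij.
have [->|->] : j = i + 1 \/ i = j + 1.
- by case: i j ij => [[|[|[|]]] p] // [[|[|[|]]] r] // _;
    (left; apply/val_inj; done) || (right; apply/val_inj).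
- by rewrite /edge corner_arc.
- by rewrite /edge orbC corner_arc.
Qed.

Lemma triangle_of_inj : injective triangle_of.
Proof.
move=> z z' E.
have C i : corner z i = corner z' i.
  have: corner z i \in triangle_of z' by rewrite -E imset_f.
  case/imsetP=> j _ zj.
  have ij : i = j by rewrite -(corner_part z i) zj corner_part.
  by rewrite zj ij.
case: z z' C {E} => h [[a b] c] [h' [[a' b'] c']] C.
have D i := congr1 coord (C i).
move: (D 0) (D 1) (D (1 + 1)); rewrite !coord_point /=.
by case=> -> -> [-> _] [-> _].
Qed.

Lemma card_solutions_le_max_triangles :
  (#|K| * #|solutions| <= max_triangles k)%N.
Proof.
apply: (bigmax_sup edge_set); first exact: admissible_edge_set.
rewrite -cardsT -cardsX -(card_imset _ triangle_of_inj).
apply/subset_leq_card/subsetP=> _ /imsetP[z zS ->].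
by apply: triangle_of_triangle; move: zS; rewrite inE => /andP[].
Qed.

End TripartiteGraph.

(** * The lower bound *)

Local Close Scope ring_scope.

Theorem theorem1p2 (p n q : nat) (p_prime : prime p) (p_odd : odd p)
  (n_gt0 : 0 < n) (q_def : q = p ^ n) :
  q ^ 17 + q ^ 15 <= max_triangles (q ^ 10).
Proof.
have n5_gt0 : 0 < n * 5 by rewrite muln_gt0 n_gt0.
have [K p_char] := pPrimePowerField p_prime n5_gt0.
rewrite expnM -q_def => card_K.
have p_q : p.-nat q by rewrite q_def pnatX pnat_id.
have q_odd : odd q by rewrite q_def oddX p_odd orbT.
have q_gt1 : 1 < q by rewrite q_def -(exp1n n) ltn_exp2r // prime_gt1.
have [x x_level] := ex_large_level p_char p_odd p_q q_odd q_gt1 card_K.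
pose t : K := (x * x ^+ (q ^ 2))%R.
pose e (i : 'I_3) (a b : K) : K :=
  (polar q a b + quad q x a - (if i == 0%R then t else 0))%R.
have e_planar i a a' b b' :
  (e i a b - e i a' b - e i a b' + e i a' b' = 0)%R -> a = a' \/ b = b'.
  have -> : (e i a b - e i a' b - e i a b' + e i a' b' =
      polar q (a - a') (b - b'))%R.
    by rewrite (polarB p_char p_q q_odd) /e; ring.
  by case/(polar_eq0 p_char p_odd q_odd card_K) => /eqP;
    rewrite subr_eq0 => /eqP; [left|right].
(* A solution is given by a, b and the sum y of the three first coordinates. *)
pose f (s : K * K * K) : K * K * K := (s.1, s.2 - s.1.1 - s.1.2)%R.
have f_inj : injective f.
  by move=> [[a b] y] [[a' b'] y'] [-> ->] /addIr/addIr ->.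
have card_sol : (q ^ 5 * q ^ 5) * (q ^ 2).+1 <= #|solutions e|.
  rewrite -card_K; apply: (leq_trans (leq_mul (leqnn _) x_level)).
  rewrite -[#|K|]cardsT -!cardsX -(card_imset _ f_inj).
  apply/subset_leq_card/subsetP=> _ /imsetP[[[a b] y] /setXP[_ yx] ->].
  move: yx; rewrite !inE /= => /eqP yx.
  have := quadD3 p_char p_q x a b (y - a - b)%R.
  have -> : (a + b + (y - a - b) = y)%R by ring.
  rewrite yx -/t /e /= => tE; apply/eqP.
  transitivity (t - t)%R; last exact: subrr.
  by rewrite [X in _ = (X - _)%R]tE; ring.
have card_KK : #|{: K * K}| = q ^ 10 by rewrite card_prod card_K -expnD.
have := card_solutions_le_max_triangles e_planar.
rewrite card_KK card_K; apply: leq_trans.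
apply: leq_trans (leq_mul (leqnn _) card_sol).
by rewrite -expnD mulnA -expnD mulnSr -expnD.
Qed.
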